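(* Consider the nonlinear program: minimize $f(x)$ subject to $\varphi_i(x)\le0$ ($i=1,\dots,s$), $\varphi_i(x)=0$ ($i=s+1,\dots,m$), where $f$ is $\mathcal C^{1,1}$ and each $\varphi_i$ is $\mathcal C^2$-smooth around a local minimizer $\bar x$. If MSCQ holds at $\bar x$, then there is $\bar y\in\mathbb{R}_+^s\times\mathbb{R}^{m-s}$ with $\nabla_xL(\bar x,\bar y)=0$ and $\langle\bar y,g(\bar x)\rangle=0$. If in addition this $\bar y$ is unique (in particular if LICQ holds at $\bar x$), then $$\langle z,w\rangle+\langle w,\nabla^2\langle\bar y,g\rangle(\bar x)w\rangle\ge0\quad\text{for all } w\in S(\bar x,\bar y),\ z\in\breve\partial^2f(\bar x)(w),$$ and if $\bar x$ is a strong local minimizer with modulus $\sigma>0$, then $\langle z,w\rangle+\langle w,\nabla^2\langle\bar y,g\rangle(\bar x)w\rangle\ge\sigma\|w\|^2$ for all such $w,z$.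
   Context: $g:=(\varphi_1,\dots,\varphi_m)$, $\Gamma$ the feasible set, $L(x,y):=f(x)+\langle y,g(x)\rangle$. $I(x):=\{i\le s:\varphi_i(x)=0\}$, $I_+(x,y):=\{i\in I(x):y_i>0\}$, $S(x,y):=\{w:\langle\nabla\varphi_i(x),w\rangle=0\ (i\in\{s+1,\dots,m\}\cup I_+(x,y)),\ \langle\nabla\varphi_i(x),w\rangle\ge0\ (i\in I(x)\setminus I_+(x,y))\}$. MSCQ at $\bar x$: $\operatorname{dist}(x;\Gamma)\le\kappa\big(\sum_{i\le s}\max\{\varphi_i(x),0\}+\sum_{i>s}|\varphi_i(x)|\big)$ for some $\kappa>0$ and all $x$ near $\bar x$. LICQ: $\{\nabla\varphi_i(\bar x):i\in I(\bar x)\cup\{s+1,\dots,m\}\}$ linearly independent. $\breve\partial^2f(\bar x)(w):=\{z:(z,-w)\in\widehat N_{\operatorname{gph}\nabla f}(\bar x,\nabla f(\bar x))\}$ with $\widehat N$ the regular (Fréchet) normal cone. Strong local minimizer with modulus $\sigma$: $f(x)\ge f(\bar x)+\frac\sigma2\|x-\bar x\|^2$ for feasible $x$ near $\bar x$. *)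

(* Defs.v *)
From HB Require Import structures.
From mathcomp Require Import all_boot all_order all_algebra.
From mathcomp Require Import classical_sets reals.
Set Implicit Arguments. Unset Strict Implicit. Unset Printing Implicit Defensive.
Import Order.TTheory GRing.Theory Num.Theory.
Local Open Scope ring_scope.
Local Open Scope classical_set_scope.

Section Defs.
Variable R : realType.

Definition dot k (u v : 'rV[R]_k) : R := \sum_(i < k) u ord0 i * v ord0 i.
Definition enorm k (u : 'rV[R]_k) : R := Num.sqrt (dot u u).

Definition dist k (x : 'rV[R]_k) (G : set 'rV[R]_k) : R :=
  inf [set enorm (x - y) | y in G].

Definition is_grad n (f : 'rV[R]_n -> R) (g x : 'rV[R]_n) : Prop :=
  forall eps : R, 0 < eps -> exists2 d : R, 0 < d &
    forall h : 'rV[R]_n, enorm h < d ->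
      `|f (x + h) - f x - dot g h| <= eps * enorm h.

(* Frechet differentiability of G : R^n -> R^n at x with Jacobian H,
   row-vector convention: G (x + h) ~ G x + h *m H. *)
Definition is_jac n (G : 'rV[R]_n -> 'rV[R]_n) (H : 'M[R]_n) (x : 'rV[R]_n)
  : Prop :=
  forall eps : R, 0 < eps -> exists2 d : R, 0 < d &
    forall h : 'rV[R]_n, enorm h < d ->
      enorm (G (x + h) - G x - h *m H) <= eps * enorm h.

Definition mx_cont_at n (H : 'rV[R]_n -> 'M[R]_n) (x : 'rV[R]_n) : Prop :=
  forall eps : R, 0 < eps -> exists2 d : R, 0 < d &
    forall y, enorm (y - x) < d -> forall i j, `|H y i j - H x i j| < eps.

(* Regular (Frechet) normal cone to Om at ub:
   limsup_{u -> ub, u in Om} <v, u - ub> / ||u - ub|| <= 0. *)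
Definition rnormal k (Om : set 'rV[R]_k) (ub v : 'rV[R]_k) : Prop :=
  forall eps : R, 0 < eps -> exists2 d : R, 0 < d &
    forall u, Om u -> enorm (u - ub) < d -> dot v (u - ub) <= eps * enorm (u - ub).

Definition gph n (G : 'rV[R]_n -> 'rV[R]_n) (D : set 'rV[R]_n) : set 'rV[R]_(n + n) :=
  [set row_mx u (G u) | u in D].

Definition ball_ n (c : 'rV[R]_n) (r : R) : set 'rV[R]_n :=
  [set u | enorm (u - c) < r].

(* Second-order subdifferential  breve-partial^2 f (xb)(w), where gf is the
   gradient map of f on the ball B(xb, d) (the regular normal cone is local). *)
Definition breve2 n (gf : 'rV[R]_n -> 'rV[R]_n) (xb : 'rV[R]_n) (d : R)
  (w z : 'rV[R]_n) : Prop :=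
  rnormal (gph gf (ball_ xb d)) (row_mx xb (gf xb)) (row_mx z (- w)).

Definition feasible n m (s : nat) (phi : 'I_m -> 'rV[R]_n -> R) : set 'rV[R]_n :=
  [set x | forall i : 'I_m, if (i < s)%N then phi i x <= 0 else phi i x == 0].

Definition MSCQ n m (s : nat) (phi : 'I_m -> 'rV[R]_n -> R) (xb : 'rV[R]_n) : Prop :=
  exists2 kappa : R, 0 < kappa & exists2 r : R, 0 < r &
    forall x, enorm (x - xb) < r ->
      dist x (feasible s phi) <=
        kappa * (\sum_(i < m | (i < s)%N) Num.max (phi i x) 0
                 + \sum_(i < m | (s <= i)%N) `|phi i x|).

Definition active n m (s : nat) (phi : 'I_m -> 'rV[R]_n -> R) (x : 'rV[R]_n) (i : 'I_m) : bool :=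
  (i < s)%N && (phi i x == 0).

Definition LICQ n m (s : nat) (phi : 'I_m -> 'rV[R]_n -> R)
  (dphi : 'I_m -> 'rV[R]_n -> 'rV[R]_n) (xb : 'rV[R]_n) : Prop :=
  forall c : 'I_m -> R,
    (forall i, ~~ (active s phi xb i || (s <= i)%N) -> c i = 0) ->
    \sum_(i < m) c i *: dphi i xb = 0 -> forall i, c i = 0.

Definition KKT n m (s : nat) (gfx : 'rV[R]_n) (phi : 'I_m -> 'rV[R]_n -> R)
  (dphi : 'I_m -> 'rV[R]_n -> 'rV[R]_n) (xb : 'rV[R]_n) (y : 'rV[R]_m) : Prop :=
  [/\ forall i : 'I_m, (i < s)%N -> 0 <= y ord0 i,
      gfx + \sum_(i < m) y ord0 i *: dphi i xb = 0 &
      \sum_(i < m) y ord0 i * phi i xb = 0].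

Definition critS n m (s : nat) (phi : 'I_m -> 'rV[R]_n -> R)
  (dphi : 'I_m -> 'rV[R]_n -> 'rV[R]_n) (xb : 'rV[R]_n) (y : 'rV[R]_m)
  (w : 'rV[R]_n) : Prop :=
  forall i : 'I_m,
    ((s <= i)%N \/ (active s phi xb i /\ 0 < y ord0 i) -> dot (dphi i xb) w = 0) /\
    (active s phi xb i /\ ~ (0 < y ord0 i) -> 0 <= dot (dphi i xb) w).

Definition local_min n (f : 'rV[R]_n -> R) (Gam : set 'rV[R]_n) (xb : 'rV[R]_n) : Prop :=
  Gam xb /\ exists2 r : R, 0 < r &
    forall x, Gam x -> enorm (x - xb) < r -> f xb <= f x.

Definition strong_local_min n (f : 'rV[R]_n -> R) (Gam : set 'rV[R]_n) (xb : 'rV[R]_n)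
  (sigma : R) : Prop :=
  Gam xb /\ exists2 r : R, 0 < r &
    forall x, Gam x -> enorm (x - xb) < r ->
      f xb + sigma / 2 * enorm (x - xb) ^+ 2 <= f x.

End Defs.

(* Main.v *)
Require Import Defs.
From HB Require Import structures.
From mathcomp Require Import all_boot all_order all_algebra.
From mathcomp Require Import ring lra.
From mathcomp Require Import classical_sets reals topology normedtype derive.
Import Order.TTheory GRing.Theory Num.Theory.
Import numFieldNormedType.Exports.
Local Open Scope ring_scope.
Local Open Scope classical_set_scope.

(* Put v = - w.  The normal cone inequality defining breve-partial^2 f, read on
   the graph points over xb + t v and integrated along the segment, gives
   f(xb + t v) <= f(xb) + t <grad f(xb), v> + t^2/2 <z, w> + o(t^2).  If the
   multiplier y is unique, Farkas' lemma yields a vector a with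
   <grad phi_i(xb), a> + 1/2 <v, hess phi_i(xb) v> equal to 0 for i > s and for
   i in I_+, and at most 0 for the other active i with <grad phi_i(xb), v> = 0:
   an obstruction would be a direction along which y can be moved inside the set
   of multipliers.  The parabola xb + t v + t^2 a then violates the constraints by
   o(t^2), so MSCQ provides feasible points at distance o(t^2) from it.  Comparing
   f there with f(xb) at order t^2 gives the second-order inequality, because
   2 <grad f(xb), a> = - 2 sum_i y_i <grad phi_i(xb), a> = <w, hess<y, g>(xb) w>.
   The existence of y is the same argument at order t, with straight lines instead
   of parabolas. *)

Set Implicit Arguments. Unset Strict Implicit.

(** * Euclidean inner product and norm on row vectors *)

Section Euclidean.
Variables (R : realType) (k : nat).
Implicit Types (u v w : 'rV[R]_k) (c : R).

Lemma dotC u v : dot u v = dot v u.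
Proof. by apply: eq_bigr => i _; rewrite mulrC. Qed.

Lemma dotDl u v w : dot (u + v) w = dot u w + dot v w.
Proof. by rewrite -big_split; apply: eq_bigr => i _; rewrite mxE mulrDl. Qed.

Lemma dotZl c u v : dot (c *: u) v = c * dot u v.
Proof. by rewrite /dot mulr_sumr; apply: eq_bigr => i _; rewrite mxE mulrA. Qed.

Lemma dotDr u v w : dot w (u + v) = dot w u + dot w v.
Proof. by rewrite dotC dotDl !(dotC _ w). Qed.

Lemma dotZr c u v : dot v (c *: u) = c * dot v u.
Proof. by rewrite dotC dotZl dotC. Qed.

Lemma dotNl u v : dot (- u) v = - dot u v.
Proof. by rewrite -scaleN1r dotZl mulN1r. Qed.

Lemma dotNr u v : dot v (- u) = - dot v u.
Proof. by rewrite -scaleN1r dotZr mulN1r. Qed.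

Lemma dotBl u v w : dot (u - v) w = dot u w - dot v w.
Proof. by rewrite dotDl dotNl. Qed.

Lemma dot0l u : dot 0 u = 0.
Proof. by rewrite -(scale0r (0 : 'rV[R]_k)) dotZl mul0r. Qed.

Lemma dot0r u : dot u 0 = 0.
Proof. by rewrite dotC dot0l. Qed.

Lemma dot_suml (I : finType) (F : I -> 'rV[R]_k) v :
  dot (\sum_i F i) v = \sum_i dot (F i) v.
Proof.
apply: (big_morph (fun u => dot u v)); last exact: dot0l.
by move=> x y; rewrite dotDl.
Qed.

Lemma dot_ge0 u : 0 <= dot u u.
Proof. by apply: sumr_ge0 => i _; rewrite -expr2 sqr_ge0. Qed.

Lemma dot_eq0 u : dot u u = 0 -> u = 0.
Proof.
move/eqP; rewrite psumr_eq0 => [/allP u0|i _]; last by rewrite -expr2 sqr_ge0.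
apply/rowP => i; rewrite mxE; apply/eqP.
by have := u0 i (mem_index_enum _); rewrite -expr2 sqrf_eq0.
Qed.

Lemma enorm_ge0 u : 0 <= enorm u.
Proof. exact: sqrtr_ge0. Qed.

Lemma sqr_enorm u : enorm u ^+ 2 = dot u u.
Proof. by rewrite sqr_sqrtr ?dot_ge0. Qed.

Lemma enorm0 : enorm (0 : 'rV[R]_k) = 0.
Proof. by rewrite /enorm dot0l sqrtr0. Qed.

Lemma enorm_eq0 u : enorm u = 0 -> u = 0.
Proof. by move=> u0; apply: dot_eq0; rewrite -sqr_enorm u0 expr0n. Qed.

Lemma enormZ c u : enorm (c *: u) = `|c| * enorm u.
Proof.
by rewrite /enorm dotZl dotZr mulrA -expr2 sqrtrM ?sqr_ge0// sqrtr_sqr.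
Qed.

Lemma enormN u : enorm (- u) = enorm u.
Proof. by rewrite -scaleN1r enormZ normrN1 mul1r. Qed.

Lemma enormBC u v : enorm (u - v) = enorm (v - u).
Proof. by rewrite -enormN opprB. Qed.

Lemma CauchySchwarz_enorm u v : dot u v <= enorm u * enorm v.
Proof.
have [v0|v_neq0] := eqVneq (enorm v) 0.
  by rewrite (enorm_eq0 v0) dot0r enorm0 mulr0.
have [u0|u_neq0] := eqVneq (enorm u) 0.
  by rewrite (enorm_eq0 u0) dot0l enorm0 mul0r.
have u_gt0 : 0 < enorm u by rewrite lt_def u_neq0 enorm_ge0.
have v_gt0 : 0 < enorm v by rewrite lt_def v_neq0 enorm_ge0.
(* The squared norm of this vector factors as 2|u||v|(|u||v| - <u, v>). *)
have := dot_ge0 (enorm v *: u - enorm u *: v).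
rewrite !(dotBl, dotDr, dotNr, dotZl, dotZr) -!sqr_enorm (dotC v u).
have uv_gt0 := mulr_gt0 u_gt0 v_gt0.
set l := (X in 0 <= X).
have -> : l = 2 * (enorm u * enorm v) * (enorm u * enorm v - dot u v).
  by rewrite /l; ring.
by rewrite pmulr_rge0 ?subr_ge0// mulr_gt0.
Qed.

Lemma ler_norm_dot u v : `|dot u v| <= enorm u * enorm v.
Proof.
by rewrite ler_norml lerNl -dotNl -{1}(enormN u) !CauchySchwarz_enorm.
Qed.

Lemma ler_enormD u v : enorm (u + v) <= enorm u + enorm v.
Proof.
rewrite -(@ler_pXn2r _ 2)// ?nnegrE ?addr_ge0 ?enorm_ge0//.
rewrite sqr_enorm !(dotDl, dotDr) sqrrD !sqr_enorm (dotC v u).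
have := CauchySchwarz_enorm u v; lra.
Qed.

End Euclidean.

Lemma dot_row_mx (R : realType) (k l : nat) (u u' : 'rV[R]_k) (v v' : 'rV[R]_l) :
  dot (row_mx u v) (row_mx u' v') = dot u u' + dot v v'.
Proof.
rewrite /dot big_split_ord/=; congr (_ + _); apply: eq_bigr => i _.
  by rewrite !row_mxEl.
by rewrite !row_mxEr.
Qed.

Lemma enorm_row_mx (R : realType) (k l : nat) (u : 'rV[R]_k) (v : 'rV[R]_l) :
  enorm (row_mx u v) <= enorm u + enorm v.
Proof.
rewrite -(@ler_pXn2r _ 2)// ?nnegrE ?addr_ge0 ?enorm_ge0//.
rewrite sqr_enorm dot_row_mx -!sqr_enorm sqrrD.
have := enorm_ge0 u; have := enorm_ge0 v; nra.
Qed.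

(** * A theorem of the alternative for linear systems *)

(* The indices in E carry equations, hence multipliers of arbitrary sign.  The
   induction removes the first vector a: if the remaining system has a solution
   x0 that a rejects, all data are projected onto the hyperplane orthogonal to a
   along x0. *)
Lemma Farkas (R : realType) (n m : nat) (E : 'I_m -> bool)
    (a : 'I_m -> 'rV[R]_n) (b : 'rV[R]_n) :
  (exists2 c : 'I_m -> R, forall i, ~~ E i -> 0 <= c i & \sum_i c i *: a i = b) \/
  (exists2 x : 'rV[R]_n,
     forall i, if E i then dot (a i) x = 0 else dot (a i) x <= 0 & 0 < dot b x).
Proof.
elim: m => [|m IH] in E a b *.
  have [b0|b_neq0] := eqVneq b 0.
    by left; exists (fun=> 0) => //; rewrite big_ord0 b0.
  right; exists b; first by case.
  by rewrite lt_def dot_ge0 andbT; apply: contra_neq b_neq0 => /dot_eq0.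
pose o := lift (@ord0 m).
have extend (c0 : R) (c : 'I_m -> R) : (~~ E ord0 -> 0 <= c0) ->
    (forall i, ~~ E (o i) -> 0 <= c i) ->
    c0 *: a ord0 + \sum_i c i *: a (o i) = b ->
    exists2 c' : 'I_m.+1 -> R, forall i, ~~ E i -> 0 <= c' i &
      \sum_i c' i *: a i = b.
  move=> c0_ge0 c_ge0 <-.
  pose c' i := if unlift ord0 i is Some j then c j else c0.
  exists c'; last first.
    rewrite big_ord_recl /c' unlift_none; congr (_ + _).
    by apply: eq_bigr => i _; rewrite liftK.
  by move=> i; rewrite /c'; case: (unliftP ord0 i) => [j|] ->; [exact: c_ge0|].
case: (IH (E \o o) (a \o o) b) => [[c c_ge0 cb]|[x0 x0P bx0]].
  by left; apply: (extend 0 c) => //; rewrite scale0r add0r -cb.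
have [ok|bad] := boolP (if E ord0 then dot (a ord0) x0 == 0
                        else dot (a ord0) x0 <= 0).
  right; exists x0 => // i; case: (unliftP ord0 i) => [j|] ->; first exact: x0P.
  by case: (E ord0) ok => // /eqP.
have a0_neq0 : dot (a ord0) x0 != 0.
  by case: (E ord0) bad => //; apply: contraNneq => ->.
set s0 := dot (a ord0) x0 in bad a0_neq0.
(* Adjoint of the projection of the unknown along [x0]; it sends [a ord0] to 0, so the first vector
   drops out of the system. *)
pose proj v := v - (dot v x0 / s0) *: a ord0.
case: (IH (E \o o) (proj \o a \o o) (proj b)) => [[c c_ge0 cb]|[x xP bx]].
  (* Pairing the combination with [x0] forces this coefficient of [a ord0]. For an inequality index
     [s0] is positive, b pairs positively with [x0] and the other terms nonpositively, so it is
     nonnegative. *)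
  left; apply: (extend ((dot b x0 - \sum_i c i * dot (a (o i)) x0) / s0) c) => //.
    move=> E0; rewrite (negbTE E0) -ltNge in bad.
    rewrite divr_ge0 ?(ltW bad)// subr_ge0.
    apply: le_trans (ltW bx0); apply: sumr_le0 => i _.
    have := x0P i => /=; case: ifPn => [_ ->|/c_ge0 ? ?]; first by rewrite mulr0.
    exact: mulr_ge0_le0.
  rewrite -[RHS](subrK ((dot b x0 / s0) *: a ord0)) -/(proj b) -cb.
  rewrite mulrBl scalerBl [LHS]addrC [X in _ + X = _]addrC addrA; congr (_ + _).
  rewrite mulr_suml scaler_suml -sumrB; apply: eq_bigr => i _.
  by rewrite /= scalerBr scalerA mulrA.
have projE v : dot v (x - (dot (a ord0) x / s0) *: x0) = dot (proj v) x.
  by rewrite dotBl dotZl dotDr dotNr dotZr; congr (_ - _); field.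
right; exists (x - (dot (a ord0) x / s0) *: x0); last by rewrite projE.
move=> i; rewrite projE; case: (unliftP ord0 i) => [j|] ->; first exact: xP.
by rewrite /proj divff// scale1r subrr dot0l; case: ifP.
Qed.

(** * Increment estimates and the second-order Taylor expansion *)

Section Taylor.
Variables (R : realType) (n : nat).
Implicit Types (F : 'rV[R]_n -> R) (G : 'rV[R]_n -> 'rV[R]_n) (x h : 'rV[R]_n).

Lemma is_gradN F (g x : 'rV[R]_n) : is_grad F g x -> is_grad (fun y => - F y) (- g) x.
Proof.
move=> Fg e /Fg[r r_gt0 Fr]; exists r => // h /Fr.
by rewrite dotNl -normrN; congr (`|_| <= _); ring.
Qed.

(** Restriction to a line turns the epsilon-delta gradient into a derivative to which the mean value
    theorem applies. *)
Lemma is_derive_line F (g x h : 'rV[R]_n) (t : R) :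
  is_grad F g (x + t *: h) -> is_derive t 1 (fun s => F (x + s *: h)) (dot g h).
Proof.
move=> Fg.
suff lim_dq : (fun k => k^-1 *: (F (x + (k *: 1 + t) *: h) - F (x + t *: h)))
    @ 0^' --> dot g h.
  by apply: DeriveDef; [exact: cvgP lim_dq|exact: cvg_lim lim_dq].
apply/cvgrPdist_le => e e_gt0.
have N_gt0 : 0 < enorm h + 1 by have := enorm_ge0 h; lra.
have [r r_gt0 Fr] := Fg _ (divr_gt0 e_gt0 N_gt0).
near=> k.
have k_neq0 : k != 0 by near: k; exact: nbhs_dnbhs_neq.
have k_gt0 : 0 < `|k| by rewrite normr_gt0.
have kh : enorm (k *: h) < r.
  rewrite enormZ; apply: (@le_lt_trans _ _ (`|k| * (enorm h + 1))).
    by rewrite ler_pM2l// lerDl.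
  by rewrite -ltr_pdivlMr//; near: k; apply: dnbhs0_lt; exact: divr_gt0.
have -> : x + (k *: 1 + t) *: h = x + t *: h + k *: h.
  by rewrite scalerDl [k *: 1]mulr1 -addrA [t *: h + _]addrC.
have := Fr _ kh; rewrite dotZr enormZ => Frk.
rewrite -(ler_pM2l k_gt0) -normrM mulrBr mulVKf// -normrN opprB.
apply: le_trans Frk _; rewrite mulrCA ler_pM2l// mulrAC ler_pdivrMr//.
by rewrite ler_pM2l// lerDl.
Unshelve. all: by end_near.
Qed.

(** Stands in for integrating [C + D * t] over [0, 1]: subtracting the primitive from F along the
    segment leaves a function with nonpositive derivative. *)
Lemma grad_increment_le F G x h (C D : R) :
  (forall t : R, 0 <= t <= 1 -> is_grad F (G (x + t *: h)) (x + t *: h)) ->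
  (forall t : R, 0 <= t <= 1 -> dot (G (x + t *: h)) h <= C + D * t) ->
  F (x + h) <= F x + C + D / 2.
Proof.
move=> FG GCD.
pose q s := F (x + s *: h) - (C * s + D / 2 * s ^+ 2).
have dq (t : R) : 0 <= t <= 1 ->
    is_derive t 1 q (dot (G (x + t *: h)) h - (C + D * t)).
  move=> t01; have := is_derive_line (FG t t01) => dF.
  by rewrite /q; apply: is_derive_eq; rewrite /GRing.scale/=; field.
have [| |c c01] := @MVT_segment R q (fun s => dot (G (x + s *: h)) h - (C + D * s))
    0 1 ler01.
- by move=> t; rewrite in_itv/= => /andP[/ltW ? /ltW ?]; apply: dq; apply/andP.
- apply: derivable_within_continuous => t; rewrite in_itv/= => t01.
  by have [] := dq t t01.
move: c01; rewrite in_itv/= => c01.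
have := GCD c c01; rewrite /q scale1r scale0r addr0; lra.
Qed.

Lemma grad_increment_norm_le F G x h (C D K : R) :
  (forall t : R, 0 <= t <= 1 -> is_grad F (G (x + t *: h)) (x + t *: h)) ->
  (forall t : R, 0 <= t <= 1 -> `|dot (G (x + t *: h)) h - (C + D * t)| <= K * t) ->
  `|F (x + h) - F x - C - D / 2| <= K / 2.
Proof.
move=> FG GK.
have up := @grad_increment_le F G x h C (D + K) FG.
have dn := @grad_increment_le (fun y => - F y) (fun y => - G y) x h (- C) (K - D)
  (fun t t01 => is_gradN (FG t t01)).
rewrite ler_norml; apply/andP; split.
- have /= := dn _; have /[swap] /[apply] : forall t : R, 0 <= t <= 1 ->
      dot (- G (x + t *: h)) h <= - C + (K - D) * t.
    by move=> t /GK; rewrite dotNl ler_norml; lra.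
  by lra.
- have := up _; have /[swap] /[apply] : forall t : R, 0 <= t <= 1 ->
      dot (G (x + t *: h)) h <= C + (D + K) * t.
    by move=> t /GK; rewrite ler_norml; lra.
  by lra.
Qed.

(** Differentiability of the gradient at x bounds the error of its linear model at x + t h by e t
    |h|; integration along the segment gives the Peano remainder. *)
Lemma Taylor2 F G (H : 'M[R]_n) (x : 'rV[R]_n) (d : R) : 0 < d ->
  (forall u, enorm (u - x) < d -> is_grad F (G u) u) -> is_jac G H x ->
  forall e : R, 0 < e -> exists2 r : R, 0 < r & forall h, enorm h < r ->
    `|F (x + h) - F x - dot (G x) h - dot (h *m H) h / 2| <= e * enorm h ^+ 2.
Proof.
move=> d_gt0 FG GH e e_gt0; have [r r_gt0 Gr] := GH e e_gt0.
exists (Num.min r d) => [|h]; first by rewrite lt_min r_gt0.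
rewrite lt_min => /andP[hr hd].
have small (B t : R) : 0 <= t <= 1 -> enorm h < B -> enorm (t *: h) < B.
  move=> /andP[t0 t1] hB; rewrite enormZ ger0_norm//.
  by apply: le_lt_trans hB; rewrite ler_piMl ?enorm_ge0.
have : e * enorm h ^+ 2 / 2 <= e * enorm h ^+ 2.
  have := mulr_ge0 (ltW e_gt0) (sqr_ge0 (enorm h)); lra.
apply: le_trans; apply: (grad_increment_norm_le) => t t01.
  by apply: FG; rewrite addrAC subrr add0r; exact: small.
have := Gr (t *: h) (small r t t01 hr).
have /andP[t0 t1] := t01.
rewrite enormZ ger0_norm// => Gt.
have -> : dot (G (x + t *: h)) h - (dot (G x) h + dot (h *m H) h * t)
    = dot (G (x + t *: h) - G x - t *: h *m H) h.
  by rewrite !dotBl -scalemxAl dotZl; ring.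
apply: le_trans (ler_norm_dot _ _) _.
rewrite (_ : e * _ * t = e * (t * enorm h) * enorm h); last by ring.
by rewrite ler_wpM2r ?enorm_ge0.
Qed.

End Taylor.

(** * Correction of curves by the error bound, and first-order conditions *)

Lemma near0_mul_lt (R : realType) (K e : R) : 0 < e ->
  \forall t \near 0^'+, t * K < e.
Proof.
move=> e_gt0; have N_gt0 : 0 < `|K| + 1 by have := normr_ge0 K; lra.
near=> t; have t_gt0 : 0 < t by near: t; exact: nbhs_right_gt.
apply: (@le_lt_trans _ _ (t * (`|K| + 1))).
  by rewrite ler_pM2l//; have := ler_norm K; lra.
rewrite -ltr_pdivlMr//; near: t; apply: nbhs_right_lt; exact: divr_gt0.
Unshelve. all: by end_near.
Qed.

Section FirstOrder.
Variables (R : realType) (n m s : nat) (phi : 'I_m -> 'rV[R]_n -> R).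
Variable xb : 'rV[R]_n.
Hypotheses (xb_feas : feasible s phi xb) (mscq : MSCQ s phi xb).

(** MSCQ turns a constraint violation o(t^p) along a curve into a distance o(t^p) to the feasible
    set. Rays use p = 1, parabolas p = 2. *)
Lemma MSCQ_curve (c : R -> 'rV[R]_n) (p : nat) :
  (forall r : R, 0 < r -> \forall t \near 0^'+, enorm (c t - xb) < r) ->
  (forall (i : 'I_m) (e : R), 0 < e -> \forall t \near 0^'+,
     (if (i < s)%N then phi i (c t) else `|phi i (c t)|) <= e * t ^+ p) ->
  forall e : R, 0 < e -> \forall t \near 0^'+,
    exists2 x, feasible s phi x & enorm (c t - x) <= e * t ^+ p.
Proof.
move=> c_near c_viol e e_gt0.
have [kappa k_gt0 [r r_gt0 Hdist]] := mscq.
(* The factor m + 1 instead of m makes the distance strictly less than e t^p, so that a feasible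
   point within this bound can be drawn from the infimum. *)
have N_gt0 : 0 < kappa * m.+1%:R by rewrite mulr_gt0// ltr0n.
have [e' e'_gt0 e'E] : exists2 e', 0 < e' & kappa * m.+1%:R * e' = e.
  exists (e / (kappa * m.+1%:R)); first by rewrite divr_gt0.
  by rewrite mulrC divfK// gt_eqF.
near=> t.
have t_gt0 : 0 < t by near: t; exact: nbhs_right_gt.
have tp_gt0 : 0 < t ^+ p by rewrite exprn_gt0.
have viol : forall i : 'I_m,
    (if (i < s)%N then phi i (c t) else `|phi i (c t)|) <= e' * t ^+ p.
  by near: t; apply: filter_forall => i; exact: c_viol.
have et_ge0 : 0 <= e' * t ^+ p by rewrite mulr_ge0 ?ltW.
have lt_dist : dist (c t) (feasible s phi) < e * t ^+ p.
  have ct : enorm (c t - xb) < r by near: t; exact: c_near.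
  apply: le_lt_trans (Hdist _ ct) _.
  apply: (@le_lt_trans _ _ (kappa * \sum_(i < m) (e' * t ^+ p))).
    rewrite ler_pM2l// [leRHS](bigID (fun i : 'I_m => (i < s)%N))/=; apply: lerD.
      by apply: ler_sum => i si; have := viol i; rewrite si ge_max et_ge0 andbT.
    under [X in _ <= X]eq_bigl do rewrite -leqNgt.
    by apply: ler_sum => i si; have := viol i; rewrite ltnNge si.
  rewrite sumr_const card_ord -mulr_natl.
  rewrite -e'E -!mulrA.
  by rewrite ltr_pM2l// ltr_pM2r ?ltr_nat ?mulr_gt0.
have [|_ [x x_feas <-] /ltW xt] := inf_lt _ lt_dist; last by exists x.
by exists (enorm (c t - xb)), xb.
Unshelve. all: by end_near.
Qed.

Variables (f : 'rV[R]_n -> R) (gf : 'rV[R]_n) (dphi : 'I_m -> 'rV[R]_n -> 'rV[R]_n).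
Hypotheses (f_grad : is_grad f gf xb)
  (phi_grad : forall i, is_grad (phi i) (dphi i xb) xb)
  (xb_min : local_min f (feasible s phi) xb).

Lemma feasible_inactive_lt0 i : ~~ (active s phi xb i || (s <= i)%N) -> phi i xb < 0.
Proof.
have := xb_feas i; rewrite /active negb_or -ltnNge.
case: ifP => [_ phi_le0 /andP[phi_neq0 _]|_ _]; last by rewrite andbF.
by rewrite lt_neqAle phi_neq0.
Qed.

Lemma is_grad_near (F : 'rV[R]_n -> R) (g w : 'rV[R]_n) : is_grad F g xb ->
  forall e : R, 0 < e -> \forall t \near 0^'+,
    `|F (xb + t *: w) - F xb - t * dot g w| <= e * t.
Proof.
move=> Fg e e_gt0.
have N_gt0 : 0 < enorm w + 1 by have := enorm_ge0 w; lra.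
have [r r_gt0 Fr] := Fg _ (divr_gt0 e_gt0 N_gt0).
near=> t.
have t_gt0 : 0 < t by near: t; exact: nbhs_right_gt.
have := Fr (t *: w); rewrite enormZ gtr0_norm// dotZr.
have -> : t * enorm w < r by near: t; exact: near0_mul_lt.
move=> /(_ isT) /le_trans; apply.
rewrite mulrAC ler_pdivrMr// -mulrA ler_pM2l//.
by rewrite ler_pM2l// lerDl.
Unshelve. all: by end_near.
Qed.

(** Without a multiplier, Farkas gives a linearized feasible direction w with <grad f(xb), w> < 0;
    MSCQ moves the ray along w into the feasible set at cost o(t), against local minimality. *)
Lemma KKT_exists : exists y, KKT s gf phi dphi xb y.
Proof.
pose rel i := active s phi xb i || (s <= i)%N.
(* Inactive inequalities enter as zero vectors: they constrain nothing, and their coefficients can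
   be reset to 0. *)
pose a i := if rel i then dphi i xb else 0.
case: (Farkas (fun i => (s <= i)%N) a (- gf)) => [[c c_ge0 sum_c]|[w wP gw]].
  exists (\row_i (if rel i then c i else 0)); split=> [i si||].
  - by rewrite mxE; case: ifP => // _; apply: c_ge0; rewrite -ltnNge.
  - apply/eqP; rewrite addrC addr_eq0 -sum_c; apply/eqP/eq_bigr => i _.
    by rewrite mxE /a; case: ifP => // _; rewrite scale0r scaler0.
  apply: big1 => i _; rewrite mxE /rel /active; case: ifP => [|_]; last by rewrite mul0r.
  case/orP => [/andP[_ /eqP->]|si]; first by rewrite mulr0.
  by have := xb_feas i; rewrite ltnNge si => /eqP->; rewrite mulr0.
exfalso.
rewrite dotNl oppr_gt0 in gw.
have w_near (r : R) : 0 < r -> \forall t \near 0^'+, enorm (xb + t *: w - xb) < r.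
  move=> r_gt0; near=> t; rewrite addrAC subrr add0r enormZ gtr0_norm//.
  by near: t; exact: near0_mul_lt.
have w_viol (i : 'I_m) (e : R) : 0 < e -> \forall t \near 0^'+,
    (if (i < s)%N then phi i (xb + t *: w) else `|phi i (xb + t *: w)|) <= e * t ^+ 1.
  move=> e_gt0.
  (* The strictly negative value of an inactive inequality absorbs its first-order term. *)
  have slack : \forall t \near 0^'+, rel i || (t * dot (dphi i xb) w < - phi i xb).
    have [_|/feasible_inactive_lt0 phi_lt0] := boolP (rel i); first exact: filterE.
    by apply: near0_mul_lt; rewrite oppr_gt0.
  near=> t.
  have t_gt0 : 0 < t by near: t; exact: nbhs_right_gt.
  have : `|phi i (xb + t *: w) - phi i xb - t * dot (dphi i xb) w| <= e * t.
    by near: t; exact: is_grad_near.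
  have : rel i || (t * dot (dphi i xb) w < - phi i xb) by near: t.
  rewrite expr1; have := wP i; rewrite /a /rel.
  have := xb_feas i; case: (leqP s i) => [si /eqP-> | si _].
    by rewrite orbT => -> _; rewrite mulr0 !subr0.
  rewrite orbF ler_norml; have [/= /andP[_ /eqP->] gi _|_ _ /=] := boolP (active _ _ _ _).
    by have : t * dot (dphi i xb) w <= 0; [rewrite pmulr_rle0|lra].
  lra.
have [_ [r r_gt0 xb_le]] := xb_min.
(* One unit of the summand 2 serves |x - xb| <= t (|w| + 1); the other leaves f(x) <= f(xb) - e
   t. *)
pose K := enorm gf + enorm w + 2.
have K_gt0 : 0 < K by rewrite /K; have := enorm_ge0 gf; have := enorm_ge0 w; lra.
pose e := Num.min 1 (- dot gf w / K).
have e_gt0 : 0 < e by rewrite lt_min ltr01 divr_gt0// oppr_gt0.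
have e_le1 : e <= 1 by rewrite ge_min lexx.
have eK : e * K <= - dot gf w by rewrite -ler_pdivlMr// ge_min lexx orbT.
have [r' r'_gt0 f_le] := f_grad e_gt0.
near (0 : R)^'+ => t.
have t_gt0 : 0 < t by near: t; exact: nbhs_right_gt.
have [x x_feas xt] : exists2 x, feasible s phi x & enorm (xb + t *: w - x) <= e * t ^+ 1.
  by near: t; exact: MSCQ_curve.
rewrite expr1 in xt.
have tr : t * (enorm w + 1) < Num.min r r'.
  by near: t; apply: near0_mul_lt; rewrite lt_min r_gt0.
have xK : enorm (x - xb) <= t * (enorm w + e).
  rewrite (_ : x - xb = (x - (xb + t *: w)) + t *: w); last first.
    by apply/rowP => i; rewrite !mxE; ring.
  apply: le_trans (ler_enormD _ _) _.
  by rewrite enormBC enormZ gtr0_norm//; lra.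
have : t * (enorm w + e) <= t * (enorm w + 1) by rewrite ler_pM2l// lerD2l.
move=> /(le_trans xK) /le_lt_trans /(_ tr); rewrite lt_min => /andP[xr xr'].
have := xb_le x x_feas xr.
have := f_le _ xr'; rewrite (addrC xb) subrK ler_norml => /andP[_ f_up] f_lo.
have dgf : dot gf (x - xb) <= t * dot gf w + enorm gf * (e * t).
  rewrite (_ : x - xb = (x - (xb + t *: w)) + t *: w); last first.
    by apply/rowP => i; rewrite !mxE; ring.
  rewrite dotDr dotZr addrC lerD2l.
  apply: le_trans (CauchySchwarz_enorm _ _) _.
  by rewrite ler_wpM2l ?enorm_ge0// enormBC.
have exK : e * enorm (x - xb) <= e * (t * (enorm w + 1)).
  rewrite ler_pM2l//; apply: le_trans xK _; rewrite ler_pM2l//; lra.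
have : t * (e * K) <= t * - dot gf w by rewrite ler_pM2l.
have : 0 < e * t by rewrite mulr_gt0.
rewrite /K; lra.
Unshelve. all: by end_near.
Qed.

End FirstOrder.

(** * Second-order expansion along parabolas, and gradient bounds from the normal cone *)

(** Hessian terms mixing v and a have order t^3, those in a alone order t^4, so at order t^2 the
    Hessian acts on v only. *)
Lemma Taylor2_curve (R : realType) (n : nat) (F : 'rV[R]_n -> R)
    (G : 'rV[R]_n -> 'rV[R]_n) (H : 'M[R]_n) (x : 'rV[R]_n) (d : R)
    (v a : 'rV[R]_n) : 0 < d ->
  (forall u, enorm (u - x) < d -> is_grad F (G u) u) -> is_jac G H x ->
  forall e : R, 0 < e -> \forall t \near 0^'+,
    `|F (x + (t *: v + t ^+ 2 *: a)) - F x - t * dot (G x) v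
      - t ^+ 2 * (dot (G x) a + dot (v *m H) v / 2)| <= e * t ^+ 2.
Proof.
move=> d_gt0 FG GH e e_gt0.
pose K := enorm v + enorm a.
have K_ge0 : 0 <= K by rewrite addr_ge0 ?enorm_ge0.
(* Half of e pays for the Taylor remainder where |h| <= t K, the other half for the terms of order
   t^3 and t^4. *)
have K2_gt0 : 0 < 2 * (K ^+ 2 + 1) by have := sqr_ge0 K; lra.
have [r r_gt0 Fr] := Taylor2 d_gt0 FG GH (divr_gt0 e_gt0 K2_gt0).
pose P := dot (v *m H) a + dot (a *m H) v; pose Q := dot (a *m H) a.
near=> t.
have t_gt0 : 0 < t by near: t; exact: nbhs_right_gt.
have t_le1 : t <= 1 by near: t; exact: nbhs_right_le.
set h := t *: v + t ^+ 2 *: a.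
have hK : enorm h <= t * K.
  apply: le_trans (ler_enormD _ _) _.
  rewrite !enormZ gtr0_norm// gtr0_norm ?exprn_gt0// mulrDr lerD2l.
  by rewrite ler_wpM2r ?enorm_ge0// ler_piMl// ltW.
have hr : enorm h < r by apply: le_lt_trans hK _; near: t; exact: near0_mul_lt.
have := Fr h hr.
have hH : dot (h *m H) h = t ^+ 2 * dot (v *m H) v + t ^+ 3 * P + t ^+ 4 * Q.
  rewrite /h /P /Q mulmxDl -!scalemxAl !(dotDl, dotDr, dotZl, dotZr).
  by ring.
have PQ : `|t * P + t ^+ 2 * Q| <= e.
  apply: le_trans (ler_normD _ _) _; rewrite !normrM !(gtr0_norm t_gt0).
  have tPQ : t * (`|P| + `|Q|) < e by near: t; exact: near0_mul_lt.
  apply: le_trans (ltW tPQ); rewrite mulrDr lerD2l.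
  by rewrite ler_wpM2r// ler_piMl// ltW.
have t2 : 0 < t ^+ 2 by rewrite exprn_gt0.
have h2 : e / (2 * (K ^+ 2 + 1)) * enorm h ^+ 2 <= e / 2 * t ^+ 2.
  have : enorm h ^+ 2 <= (t * K) ^+ 2.
    by rewrite ler_pXn2r// ?nnegrE ?enorm_ge0// mulr_ge0// ltW.
  move=> hK2; rewrite mulrAC ler_pdivrMr//.
  rewrite (_ : _ * (2 * _) = e * ((t * K) ^+ 2 + t ^+ 2)); last by field.
  rewrite ler_pM2l//; apply: le_trans hK2 _; lra.
move=> /le_trans/(_ h2); rewrite hH /h dotDr !dotZr => FE.
rewrite (_ : _ - _ - _ - _ = (F (x + h) - F x - (t * dot (G x) v + t ^+ 2 * dot (G x) a)
  - (t ^+ 2 * dot (v *m H) v + t ^+ 3 * P + t ^+ 4 * Q) / 2)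
  + t ^+ 2 * ((t * P + t ^+ 2 * Q) / 2)); last by rewrite /h; field.
apply: le_trans (ler_normD _ _) _.
rewrite normrM (gtr0_norm t2).
have : t ^+ 2 * `|(t * P + t ^+ 2 * Q) / 2| <= t ^+ 2 * (e / 2).
  by rewrite ler_pM2l// normrM [`|2^-1|]gtr0_norm ?invr_gt0//; lra.
by rewrite /h; lra.
Unshelve. all: by end_near.
Qed.

(** The normal cone inequality for (z, -w) is tested at the graph point over xb - t w; the Lipschitz
    bound keeps that point within t K of the base point, so the error is at most e t. *)
Lemma breve2_upper (R : realType) (n : nat) (gf : 'rV[R]_n -> 'rV[R]_n)
    (xb : 'rV[R]_n) (d L : R) (w z : 'rV[R]_n) : 0 < d ->
  (forall u1 u2, enorm (u1 - xb) < d -> enorm (u2 - xb) < d ->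
       enorm (gf u1 - gf u2) <= L * enorm (u1 - u2)) ->
  breve2 gf xb d w z ->
  forall e : R, 0 < e -> exists2 r : R, 0 < r & forall t, 0 <= t < r ->
    dot (gf (xb + t *: - w) - gf xb) (- w) <= t * (dot z w + e).
Proof.
move=> d_gt0 gfL wz e e_gt0.
pose K := (1 + `|L|) * enorm w.
have K_ge0 : 0 <= K by rewrite mulr_ge0 ?enorm_ge0// addr_ge0.
have K_gt0 : 0 < K + 1 by lra.
have [r r_gt0 Hr] := wz _ (divr_gt0 e_gt0 K_gt0).
have W_gt0 : 0 < enorm w + 1 by have := enorm_ge0 w; lra.
exists (Num.min (r / (K + 1)) (d / (enorm w + 1))).
  by rewrite lt_min !divr_gt0.
move=> t /andP[t_ge0]; rewrite lt_min !ltr_pdivlMr// => /andP[tr td].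
have tw : enorm (xb + t *: - w - xb) = t * enorm w.
  by rewrite addrAC subrr add0r enormZ enormN ger0_norm.
have twd : enorm (xb + t *: - w - xb) < d.
  by rewrite tw; apply: le_lt_trans td; rewrite ler_wpM2l// lerDl.
have xbd : enorm (xb - xb) < d by rewrite subrr enorm0.
have gft : enorm (gf (xb + t *: - w) - gf xb) <= `|L| * (t * enorm w).
  apply: le_trans (gfL _ _ twd xbd) _; rewrite tw ler_wpM2r ?ler_norm//.
  by rewrite mulr_ge0// enorm_ge0.
set u := row_mx (xb + t *: - w) (gf (xb + t *: - w)).
have uE : u - row_mx xb (gf xb) =
    row_mx (t *: - w) (gf (xb + t *: - w) - gf xb).
  by rewrite /u opp_row_mx add_row_mx [xb + _ - xb]addrAC subrr add0r.
have uK : enorm (u - row_mx xb (gf xb)) <= t * K.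
  rewrite uE; apply: le_trans (enorm_row_mx _ _) _.
  rewrite enormZ enormN ger0_norm// /K; apply: le_trans (lerD (lexx _) gft) _.
  by rewrite le_eqVlt; apply/orP; left; apply/eqP; ring.
have ur : enorm (u - row_mx xb (gf xb)) < r.
  by apply: le_lt_trans uK _; apply: le_lt_trans tr; rewrite ler_wpM2l// lerDl.
have graph_u : gph gf (Defs.ball_ xb d) u by exists (xb + t *: - w).
have := Hr u graph_u ur.
have : e / (K + 1) * enorm (u - row_mx xb (gf xb)) <= t * e.
  rewrite mulrAC ler_pdivrMr// [leRHS](_ : _ = e * (t * (K + 1))); last by ring.
  rewrite ler_pM2l//.
  by apply: le_trans uK _; rewrite ler_wpM2l// lerDl.
rewrite uE dot_row_mx dotZr [dot z _]dotNr [dot (- w) _]dotC; lra.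
Qed.

(** * The second-order linearized constraint system *)

(** Homogenization: Farkas is applied to the rows (g_i, q_i) and the target (0, 1), then a is
    rescaled. The other alternative gives sum c_i g_i = 0 and sum c_i q_i = 1, impossible since the
    hypothesis forces c = 0. *)
Lemma second_order_direction (R : realType) (n m : nat) (J E : 'I_m -> bool)
    (g : 'I_m -> 'rV[R]_n) (q : 'I_m -> R) :
  (forall c : 'I_m -> R, (forall i, ~~ J i -> c i = 0) ->
     (forall i, J i -> ~~ E i -> 0 <= c i) ->
     \sum_i c i *: g i = 0 -> forall i, c i = 0) ->
  exists a : 'rV[R]_n, forall i, J i ->
    if E i then dot (g i) a + q i = 0 else dot (g i) a + q i <= 0.
Proof.
move=> no_mult.
pose A i : 'rV[R]_(n + 1) := if J i then row_mx (g i) (q i)%:M else 0.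
pose b : 'rV[R]_(n + 1) := row_mx 0 1%:M.
have dot1 (x : 'rV[R]_(n + 1)) u (p : R) :
    dot (row_mx u p%:M) x = dot u (lsubmx x) + p * rsubmx x 0 0.
  rewrite -{1}(hsubmxK x) dot_row_mx; congr (_ + _).
  by rewrite /dot big_ord1 mxE eqxx mulr1n.
case: (Farkas E A b) => [[c c_ge0 sum_c]|[x xA bx]].
  (* Rows outside J are zero, so the coefficients there may be reset to 0 as the hypothesis
     requires. *)
  have cJ i : ~~ J i -> (if J i then c i else 0) = 0 by move/negbTE->.
  have cA i : c i *: A i = (if J i then c i else 0) *: row_mx (g i) (q i)%:M.
    by rewrite /A; case: ifP; rewrite ?scaler0 ?scale0r.
  have c0 := no_mult (fun i => if J i then c i else 0) cJ.
  have : 1%:M = 0 :> 'M[R]_1.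
    rewrite -(row_mxKr (0 : 'rV[R]_n) 1%:M) -/b -sum_c linear_sum big1// => i _.
    rewrite cA c0 ?scale0r ?linear0// => [j -> nE|].
      exact: c_ge0.
    transitivity (lsubmx b); last by rewrite row_mxKl.
    by rewrite -sum_c linear_sum; apply: eq_bigr => j _; rewrite cA linearZ/= row_mxKl.
  by move/matrixP/(_ 0 0); rewrite !mxE => /eqP; rewrite oner_eq0.
have {bx}tau_gt0 : 0 < rsubmx x 0 0.
  by move: bx; rewrite /b dot1 dot0l add0r mul1r.
set tau := rsubmx x 0 0 in tau_gt0.
exists (tau^-1 *: lsubmx x) => i Ji.
have := xA i; rewrite /A Ji dot1 -/tau dotZr.
have -> : tau^-1 * dot (g i) (lsubmx x) + q i =
    tau^-1 * (dot (g i) (lsubmx x) + q i * tau) by field; rewrite gt_eqF.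
by case: ifP => _ => [->|]; rewrite ?mulr0// pmulr_rle0 ?invr_gt0.
Qed.

(** * Growth of the objective near a parabola *)

Section Objective.
Variables (R : realType) (n : nat) (f : 'rV[R]_n -> R) (gf : 'rV[R]_n -> 'rV[R]_n).
Variables (xb : 'rV[R]_n) (d L : R).
Hypotheses (d_gt0 : 0 < d)
  (f_grad : forall u, enorm (u - xb) < d -> is_grad f (gf u) u)
  (gf_lip : forall u1 u2, enorm (u1 - xb) < d -> enorm (u2 - xb) < d ->
       enorm (gf u1 - gf u2) <= L * enorm (u1 - u2)).

(** On the segment from xb to xb - t w the bound of [breve2_upper] is linear in the parameter;
    integration produces the factor 1/2. *)
Lemma breve2_increment_le (w z : 'rV[R]_n) : breve2 gf xb d w z ->
  forall e : R, 0 < e -> \forall t \near 0^'+,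
    f (xb + t *: - w) <= f xb - t * dot (gf xb) w + t ^+ 2 * (dot z w + e) / 2.
Proof.
move=> wz e e_gt0.
have [r r_gt0 gf_le] := breve2_upper d_gt0 gf_lip wz e_gt0.
near=> t.
have t_gt0 : 0 < t by near: t; exact: nbhs_right_gt.
have tr : t < r by near: t; exact: nbhs_right_lt.
have td : t * enorm w < d by near: t; exact: near0_mul_lt.
have := @grad_increment_le _ _ f gf xb (t *: - w) (- (t * dot (gf xb) w))
  (t ^+ 2 * (dot z w + e)); apply=> s /andP[s_ge0 s_le1]; rewrite scalerA.
  apply: f_grad; rewrite addrAC subrr add0r enormZ enormN.
  rewrite ger0_norm ?mulr_ge0 ?(ltW t_gt0)//; apply: le_lt_trans td.
  by rewrite -mulrA ler_piMl// mulr_ge0 ?enorm_ge0// ltW.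
have st : 0 <= s * t < r.
  rewrite mulr_ge0 ?(ltW t_gt0)//=; apply: le_lt_trans tr.
  by rewrite ler_piMl// ltW.
have := gf_le _ st; rewrite -(ler_pM2l t_gt0) dotZr dotBl [dot (gf xb) _]dotNr.
lra.
Unshelve. all: by end_near.
Qed.

(** The gradient is taken at xb rather than u: for u - xb of size O(t) and k of size O(t^2) the
    error is still O(t^3). *)
Lemma Lipschitz_increment_le (u k : 'rV[R]_n) :
  enorm (u - xb) + enorm k < d ->
  f (u + k) <= f u + dot (gf xb) k + `|L| * ((enorm (u - xb) + enorm k) * enorm k).
Proof.
move=> ukd.
have uk_le (t : R) : 0 <= t <= 1 ->
    enorm (u + t *: k - xb) <= enorm (u - xb) + enorm k.
  move=> /andP[t_ge0 t_le1]; rewrite addrAC; apply: le_trans (ler_enormD _ _) _.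
  by rewrite lerD2l enormZ ger0_norm// ler_piMl ?enorm_ge0.
have := @grad_increment_le _ _ f gf u k (dot (gf xb) k +
  `|L| * ((enorm (u - xb) + enorm k) * enorm k)) 0.
rewrite mul0r addr0 addrA; apply=> t t01.
  by apply: f_grad; exact: le_lt_trans (uk_le t t01) ukd.
rewrite mul0r addr0 -lerBlDl -dotBl.
apply: le_trans (CauchySchwarz_enorm _ _) _.
rewrite mulrA ler_wpM2r ?enorm_ge0//.
apply: le_trans (gf_lip _ _) _.
- exact: le_lt_trans (uk_le t t01) ukd.
- by rewrite subrr enorm0.
apply: (@le_trans _ _ (`|L| * enorm (u + t *: k - xb))).
  by rewrite ler_wpM2r ?enorm_ge0// ler_norm.
by rewrite ler_wpM2l// uk_le.
Qed.

(** A feasible x near the parabola is (xb - t w) + k with k = t^2 a + o(t^2): the normal cone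
    controls f on the first step, the Lipschitz gradient on the second. The value sigma = 0 covers
    plain local minimizers. *)
Lemma parabolic_growth (Gam : set 'rV[R]_n) (sigma : R) (w z a : 'rV[R]_n) :
  0 <= sigma -> strong_local_min f Gam xb sigma ->
  breve2 gf xb d w z -> dot (gf xb) w = 0 ->
  (forall e : R, 0 < e -> \forall t \near 0^'+,
     exists2 x, Gam x &
       enorm (xb + (t *: - w + t ^+ 2 *: a) - x) <= e * t ^+ 2) ->
  sigma * enorm w ^+ 2 <= dot z w + 2 * dot (gf xb) a.
Proof.
move=> sigma_ge0 [_ [r r_gt0 growth]] wz gfw feas.
apply/ler_addgt0Pr => e0 e0_gt0.
(* After doubling, the errors are e times: 1 from the normal cone, 2 from the Lipschitz remainder, 2
   from the bound on |x - xb|^2, and 2|grad f(xb)| from the error in k. *)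
pose N := 5 + 2 * enorm (gf xb).
have N_gt0 : 0 < N by rewrite /N; have := enorm_ge0 (gf xb); lra.
pose e := Num.min 1 (e0 / N).
have e_gt0 : 0 < e by rewrite lt_min ltr01 divr_gt0.
have e_le1 : e <= 1 by rewrite ge_min lexx.
have eN : e * N <= e0 by rewrite -ler_pdivlMr// ge_min lexx orbT.
pose A := enorm a + 1.
have A_ge0 : 0 <= A by rewrite addr_ge0 ?enorm_ge0.
have w_ge0 := enorm_ge0 w.
near (0 : R)^'+ => t.
have t_gt0 : 0 < t by near: t; exact: nbhs_right_gt.
have t_le1 : t <= 1 by near: t; exact: nbhs_right_le.
have t_ge0 := ltW t_gt0.
have t2_gt0 : 0 < t ^+ 2 by rewrite exprn_gt0.
have [x x_feas xt] : exists2 x, Gam x &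
    enorm (xb + (t *: - w + t ^+ 2 *: a) - x) <= e * t ^+ 2.
  by near: t; exact: feas.
have f_w : f (xb + t *: - w) <= f xb - t * dot (gf xb) w + t ^+ 2 * (dot z w + e) / 2.
  by near: t; exact: breve2_increment_le.
have trd : t * (enorm w + A) < Num.min r d.
  by near: t; apply: near0_mul_lt; rewrite lt_min r_gt0.
have tL : t * (`|L| * ((enorm w + A) * A)) < e by near: t; exact: near0_mul_lt.
have tS : t * (sigma * enorm w * A) < e by near: t; exact: near0_mul_lt.
pose k := x - (xb + t *: - w).
have kE : k = t ^+ 2 *: a - (xb + (t *: - w + t ^+ 2 *: a) - x).
  by apply/rowP => i; rewrite !mxE; ring.
have k_le : enorm k <= t ^+ 2 * A.
  rewrite kE; apply: le_trans (ler_enormD _ _) _.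
  rewrite enormN enormZ gtr0_norm// mulrDr lerD2l.
  apply: le_trans xt _; rewrite mulrC ler_pM2l//.
have tA : t ^+ 2 * A <= t * A by rewrite ler_wpM2r// ler_piMl// ltW.
have tw : enorm (xb + t *: - w - xb) = t * enorm w.
  by rewrite addrAC subrr add0r enormZ enormN gtr0_norm.
move: trd; rewrite lt_min mulrDr => /andP[tr td].
have xk : xb + t *: - w + k = x by rewrite /k addrC subrK.
have := @Lipschitz_increment_le (xb + t *: - w) k; rewrite tw xk.
have -> : t * enorm w + enorm k < d by lra.
move=> /(_ isT) f_x.
have L_le : `|L| * ((t * enorm w + enorm k) * enorm k) <= t ^+ 2 * e.
  apply: (@le_trans _ _ (t ^+ 2 * (t * (`|L| * ((enorm w + A) * A))))).
    rewrite (_ : t ^+ 2 * _ = `|L| * ((t * (enorm w + A)) * (t ^+ 2 * A))); last by ring.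
    rewrite ler_wpM2l// ler_pM ?enorm_ge0 ?addr_ge0 ?enorm_ge0 ?mulr_ge0//.
    by rewrite mulrDr; lra.
  by rewrite ler_pM2l// ltW.
have gf_k : dot (gf xb) k <= t ^+ 2 * dot (gf xb) a + t ^+ 2 * (enorm (gf xb) * e).
  rewrite kE dotDr dotZr lerD2l -[- _]opprK; apply: le_trans (CauchySchwarz_enorm _ _) _.
  rewrite opprK enormN (_ : t ^+ 2 * _ = enorm (gf xb) * (e * t ^+ 2)); last by ring.
  by rewrite ler_wpM2l ?enorm_ge0.
have xw : t * enorm w <= enorm (x - xb) + t ^+ 2 * A.
  rewrite -tw (_ : _ - xb = x - xb - k); last by apply/rowP => i; rewrite !mxE; ring.
  by apply: le_trans (ler_enormD _ _) _; rewrite enormN lerD2l.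
have x_r : enorm (x - xb) < r.
  rewrite (_ : x - xb = (xb + t *: - w - xb) + k); last first.
    by apply/rowP => i; rewrite !mxE; ring.
  by apply: le_lt_trans (ler_enormD _ _) _; rewrite tw; lra.
have xw2 : t ^+ 2 * (enorm w ^+ 2 - 2 * t * enorm w * A) <= enorm (x - xb) ^+ 2.
  have x_ge0 := enorm_ge0 (x - xb).
  have tW : 0 <= t * enorm w by rewrite mulr_ge0.
  have tA0 : 0 <= t ^+ 2 * A by rewrite mulr_ge0// ltW.
  rewrite (_ : t ^+ 2 * _ = (t * enorm w) ^+ 2 - 2 * (t * enorm w) * (t ^+ 2 * A));
    last by ring.
  move: (t * enorm w) (t ^+ 2 * A) (enorm (x - xb)) xw x_ge0 tW tA0.
  (* If p <= B, then p^2 - 2 p B is nonpositive; otherwise X >= p - B >= 0 can be squared. *)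
  move=> p B X pXB X_ge0 p_ge0 B_ge0; have [pB|/ltW Bp] := leP p B; nra.
have := growth x x_feas x_r.
have sw2 : sigma / 2 * (t ^+ 2 * (enorm w ^+ 2 - 2 * t * enorm w * A)) <=
    sigma / 2 * enorm (x - xb) ^+ 2 by rewrite ler_wpM2l// divr_ge0.
have tS2 : t ^+ 2 * (t * (sigma * enorm w * A)) <= t ^+ 2 * e by rewrite ler_pM2l// ltW.
rewrite gfw mulr0 subr0 in f_w.
move=> growth_x.
suff : t ^+ 2 * (sigma * enorm w ^+ 2) <= t ^+ 2 * (dot z w + 2 * dot (gf xb) a + e * N).
  rewrite ler_pM2l//; lra.
rewrite /N; lra.
Unshelve. all: by end_near.
Qed.

End Objective.

(** * Support and uniqueness of multipliers *)

(** The indices where S(x, y) imposes an equation; there the sign condition lets y move in both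
    directions. *)
Definition strongly_active (R : realType) (n m s : nat) (phi : 'I_m -> 'rV[R]_n -> R)
    (xb : 'rV[R]_n) (y : 'rV[R]_m) (i : 'I_m) : bool :=
  (s <= i)%N || active s phi xb i && (0 < y ord0 i).

Section Multipliers.
Variables (R : realType) (n m s : nat) (gfx : 'rV[R]_n) (phi : 'I_m -> 'rV[R]_n -> R).
Variables (dphi : 'I_m -> 'rV[R]_n -> 'rV[R]_n) (xb : 'rV[R]_n) (y : 'rV[R]_m).
Hypotheses (xb_feas : feasible s phi xb) (y_KKT : KKT s gfx phi dphi xb y).

Let E := strongly_active s phi xb y.

(** All terms y_i phi_i(xb) are nonpositive and sum to 0, so each vanishes. *)
Lemma KKT_support i : ~~ E i -> y ord0 i = 0.
Proof.
have [y_ge0 _ compl] := y_KKT.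
have term_le0 j : y ord0 j * phi j xb <= 0.
  have := xb_feas j; case: ifPn => [sj phi_le0|_ /eqP->]; last by rewrite mulr0.
  by rewrite mulr_ge0_le0// y_ge0.
rewrite /E /strongly_active negb_or -ltnNge => /andP[si].
have := y_ge0 i si; rewrite le_eqVlt => /predU1P[<-//|y_gt0].
rewrite y_gt0 andbT /active si/= => /negP[].
have : - \sum_j y ord0 j * phi j xb == 0 by rewrite compl oppr0.
rewrite -sumrN psumr_eq0 => [/allP/(_ i (mem_index_enum _))/=|j _].
  by rewrite oppr_eq0 mulf_eq0 (gt_eqF y_gt0).
by rewrite oppr_ge0.
Qed.

(** Stationarity paired with x. It is used for x = w with b = 0, and for x = a with b = -q. *)
Lemma KKT_dot (x : 'rV[R]_n) (b : 'I_m -> R) :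
  (forall i, E i -> dot (dphi i xb) x = b i) ->
  dot gfx x = - \sum_i y ord0 i * b i.
Proof.
move=> Eb; have [_ /eqP + _] := y_KKT; rewrite addr_eq0 => /eqP->.
rewrite dotNl dot_suml; congr (- _); apply: eq_bigr => i _; rewrite dotZl.
have [/Eb->//|/KKT_support->] := boolP (E i); by rewrite !mul0r.
Qed.

(* A nontrivial such combination could be added to y with a small positive
   coefficient, producing a second multiplier. *)
Lemma unique_multiplier_independence (c : 'I_m -> R) :
  (forall y', KKT s gfx phi dphi xb y' -> y' = y) ->
  (forall i, ~~ (active s phi xb i || (s <= i)%N) -> c i = 0) ->
  (forall i, ~~ E i -> 0 <= c i) ->
  \sum_i c i *: dphi i xb = 0 -> forall i, c i = 0.
Proof.
move=> y_uniq c_supp c_ge0 sum_c i.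
have [y_ge0 stat compl] := y_KKT.
near (0 : R)^'+ => t.
have t_gt0 : 0 < t by near: t; exact: nbhs_right_gt.
(* Positive components of y stay positive in y + t c. *)
have tc : forall j : 'I_m, (0 < y ord0 j) ==> (t * - c j < y ord0 j).
  near: t; apply: filter_forall => j.
  by have [y_gt0|_] := boolP (0 < y ord0 j); [exact: near0_mul_lt|exact: filterE].
have /rowP/(_ i) : y + t *: \row_j c j = y.
  apply: y_uniq; split=> [j sj||].
  - rewrite !mxE; have [Ej|nE] := boolP (E j); last first.
      by rewrite addr_ge0 ?y_ge0// mulr_ge0 ?c_ge0// ltW.
    move: Ej; rewrite /E /strongly_active leqNgt sj => /andP[_ y_gt0].
    by have := tc j; rewrite y_gt0/=; lra.
  - under eq_bigr do rewrite !mxE scalerDl -scalerA.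
    by rewrite big_split/= -scaler_sumr sum_c scaler0 addr0.
  - under eq_bigr do rewrite !mxE mulrDl.
    rewrite big_split/= compl add0r big1// => j _.
    have [|/c_supp->] := boolP (active s phi xb j || (s <= j)%N); last by rewrite mulr0 mul0r.
    case/orP => [/andP[_ /eqP->]|sj]; first by rewrite mulr0.
    by have := xb_feas j; rewrite ltnNge sj => /eqP->; rewrite mulr0.
rewrite !mxE => /eqP; rewrite -subr_eq0 addrAC subrr add0r mulf_eq0 (gt_eqF t_gt0).
by move/eqP.
Unshelve. all: by end_near.
Qed.

End Multipliers.

(** * The second-order necessary condition *)

Lemma second_order_necessary (R : realType) (n m s : nat)
    (f : 'rV[R]_n -> R) (phi : 'I_m -> 'rV[R]_n -> R) (xb : 'rV[R]_n)
    (d L sigma : R) (gf : 'rV[R]_n -> 'rV[R]_n)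
    (dphi : 'I_m -> 'rV[R]_n -> 'rV[R]_n) (hphi : 'I_m -> 'rV[R]_n -> 'M[R]_n)
    (y : 'rV[R]_m) (w z : 'rV[R]_n) :
  0 < d ->
  (forall u, enorm (u - xb) < d -> is_grad f (gf u) u) ->
  (forall u1 u2, enorm (u1 - xb) < d -> enorm (u2 - xb) < d ->
     enorm (gf u1 - gf u2) <= L * enorm (u1 - u2)) ->
  (forall i u, enorm (u - xb) < d -> is_grad (phi i) (dphi i u) u) ->
  (forall i, is_jac (dphi i) (hphi i xb) xb) ->
  MSCQ s phi xb ->
  0 <= sigma -> strong_local_min f (feasible s phi) xb sigma ->
  KKT s (gf xb) phi dphi xb y ->
  (forall y', KKT s (gf xb) phi dphi xb y' -> y' = y) ->
  critS s phi dphi xb y w -> breve2 gf xb d w z ->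
  sigma * enorm w ^+ 2 <=
    dot z w + dot w (w *m \sum_(i < m) y ord0 i *: hphi i xb).
Proof.
move=> d_gt0 f_grad gf_lip phi_grad phi_jac mscq sigma_ge0 xb_min y_KKT y_uniq w_crit wz.
have xb_feas : feasible s phi xb by case: xb_min.
pose E := strongly_active s phi xb y.
(* Constraints that stay at 0 to first order along -w; for these the t^2 term decides. *)
pose J (i : 'I_m) := (s <= i)%N || active s phi xb i && (dot (dphi i xb) w == 0).
pose q (i : 'I_m) := dot (w *m hphi i xb) w / 2.
have E_w i : E i -> dot (dphi i xb) w = 0.
  case/orP => [si|/andP[? ?]]; first by apply: (w_crit i).1; left.
  by apply: (w_crit i).1; right.
have E_J i : E i -> J i.
  by move=> Ei; rewrite /J E_w// eqxx andbT; case/orP: Ei => [->//|/andP[->]]; rewrite orbT.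
have [a aP] : exists a : 'rV[R]_n, forall i, J i ->
    if E i then dot (dphi i xb) a + q i = 0 else dot (dphi i xb) a + q i <= 0.
  apply: second_order_direction => c cJ c_ge0.
  apply: (unique_multiplier_independence xb_feas y_KKT y_uniq).
    move=> i nact; apply: cJ; apply: contraNN nact.
    by rewrite /J => /orP[->|/andP[-> _]//]; rewrite orbT.
  move=> i nEi; have [Ji|/cJ->//] := boolP (J i); exact: c_ge0.
have gf_w : dot (gf xb) w = 0.
  rewrite (KKT_dot xb_feas y_KKT (b := fun=> 0) E_w) ?big1 ?oppr0//.
  by move=> i _; rewrite mulr0.
(* On strongly active indices <grad phi_i(xb), a> = -q_i; the factor 2 cancels the 1/2 in [q]. *)
have gf_a : 2 * dot (gf xb) a = dot w (w *m \sum_i y ord0 i *: hphi i xb).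
  rewrite (KKT_dot xb_feas y_KKT (b := fun i => - q i)); last first.
    by move=> i Ei; have := aP i (E_J i Ei); rewrite [E i]Ei => /eqP; rewrite addr_eq0 => /eqP.
  rewrite mulmx_sumr dotC dot_suml -sumrN mulr_sumr; apply: eq_bigr => i _.
  by rewrite -scalemxAr dotZl /q; field.
rewrite -gf_a.
apply: (parabolic_growth d_gt0 f_grad gf_lip sigma_ge0 xb_min wz gf_w) => e e_gt0.
have curve_near (r : R) : 0 < r ->
    \forall t \near 0^'+, enorm (xb + (t *: - w + t ^+ 2 *: a) - xb) < r.
  move=> r_gt0; near=> t.
  have t_gt0 : 0 < t by near: t; exact: nbhs_right_gt.
  have t_le1 : t <= 1 by near: t; exact: nbhs_right_le.
  have tr : t * (enorm w + enorm a) < r by near: t; exact: near0_mul_lt.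
  rewrite addrAC subrr add0r; apply: le_lt_trans (ler_enormD _ _) _.
  rewrite !enormZ enormN gtr0_norm// gtr0_norm ?exprn_gt0//.
  apply: le_lt_trans tr; rewrite mulrDr lerD2l ler_wpM2r ?enorm_ge0//.
  by rewrite ler_piMl// ltW.
apply: (MSCQ_curve xb_feas mscq) => // i {}e {}e_gt0.
pose b := dot (dphi i xb) a + q i.
(* Outside J either phi_i(xb) or the slope along -w is negative, and it dominates for small t. *)
have slack : \forall t \near 0^'+,
    J i || (phi i xb - t * dot (dphi i xb) w + t ^+ 2 * b <= 0).
  have [_|nJ] := boolP (J i); first exact: filterE.
  have si : (i < s)%N by move: nJ; rewrite /J negb_or -ltnNge => /andP[].
  have phi_le0 : phi i xb <= 0 by have := xb_feas i; rewrite si.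
  have [act|nact] := boolP (active s phi xb i).
    have phi0 : phi i xb = 0 by case/andP: act => _ /eqP.
    have gw_gt0 : 0 < dot (dphi i xb) w.
      rewrite lt_def; apply/andP; split.
        by move: nJ; rewrite /J negb_or act/= => /andP[].
      apply: (w_crit i).2; split=> // y_gt0; move/negP: nJ; apply.
      by apply: E_J; rewrite /E /strongly_active act y_gt0 orbT.
    near=> t.
    have t_gt0 : 0 < t by near: t; exact: nbhs_right_gt.
    have tb : t * b < dot (dphi i xb) w by near: t; exact: near0_mul_lt.
    have : t * (t * b) < t * dot (dphi i xb) w by rewrite ltr_pM2l.
    by rewrite phi0/=; lra.
  have phi_lt0 : phi i xb < 0.
    by apply: (feasible_inactive_lt0 xb_feas); rewrite negb_or nact -ltnNge.
  near=> t.
  have t_gt0 : 0 < t by near: t; exact: nbhs_right_gt.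
  have t_le1 : t <= 1 by near: t; exact: nbhs_right_le.
  have tb : t * (`|dot (dphi i xb) w| + `|b|) < - phi i xb.
    by near: t; apply: near0_mul_lt; rewrite oppr_gt0.
  have : t * - dot (dphi i xb) w <= t * `|dot (dphi i xb) w|.
    by rewrite ler_pM2l// -normrN ler_norm.
  have : t * (t * b) <= t * `|b|.
    rewrite ler_pM2l//; apply: le_trans (ler_norm _) _.
    by rewrite normrM gtr0_norm// ler_piMl.
  by rewrite /=; lra.
near=> t.
have : `|phi i (xb + (t *: - w + t ^+ 2 *: a)) - phi i xb - t * dot (dphi i xb) (- w)
    - t ^+ 2 * (dot (dphi i xb) a + dot (- w *m hphi i xb) (- w) / 2)| <= e * t ^+ 2.
  near: t; exact: (Taylor2_curve (- w) a d_gt0 (phi_grad i) (phi_jac i)).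
rewrite mulNmx !dotNr dotNl opprK -/(q i) -/b mulrN opprK.
have : J i || (phi i xb - t * dot (dphi i xb) w + t ^+ 2 * b <= 0) by near: t.
have t2_gt0 : 0 < t ^+ 2 by rewrite exprn_gt0//; near: t; exact: nbhs_right_gt.
case: ltnP => si.
  have phi_le0 : phi i xb <= 0 by have := xb_feas i; rewrite si.
  rewrite ler_norml; case/orP => [Ji|] ; last by lra.
  have : t ^+ 2 * b <= 0.
    by rewrite pmulr_rle0//; have := aP i Ji; rewrite -/b; case: ifP => // _ ->.
  have -> : dot (dphi i xb) w = 0.
    by move: Ji; rewrite /J leqNgt si => /andP[_ /eqP].
  lra.
have Ei : E i by rewrite /E /strongly_active si.
have -> : b = 0 by have := aP i (E_J i Ei); rewrite Ei.
have := xb_feas i; rewrite ltnNge si => /eqP->.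
by rewrite E_w// !mulr0 !subr0 !addr0.
Unshelve. all: by end_near.
Qed.

(** * Existence, uniqueness under LICQ, and both second-order inequalities *)

Unset Implicit Arguments.

Theorem theorem9p2 (R : realType) (n m s : nat)
  (f : 'rV[R]_n -> R) (phi : 'I_m -> 'rV[R]_n -> R) (xb : 'rV[R]_n)
  (d : R) (gf : 'rV[R]_n -> 'rV[R]_n)
  (dphi : 'I_m -> 'rV[R]_n -> 'rV[R]_n) (hphi : 'I_m -> 'rV[R]_n -> 'M[R]_n) :
  (s <= m)%N ->
  0 < d ->
  (* f is C^{1,1} around xb, with gradient gf on the ball B(xb, d) *)
  (forall u, enorm (u - xb) < d -> is_grad f (gf u) u) ->
  (exists L : R, forall u1 u2, enorm (u1 - xb) < d -> enorm (u2 - xb) < d ->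
       enorm (gf u1 - gf u2) <= L * enorm (u1 - u2)) ->
  (* each phi_i is C^2 around xb, with gradient dphi i and Hessian hphi i *)
  (forall i u, enorm (u - xb) < d ->
     [/\ is_grad (phi i) (dphi i u) u, is_jac (dphi i) (hphi i u) u
       & mx_cont_at (hphi i) u]) ->
  local_min f (feasible s phi) xb ->
  MSCQ s phi xb ->
  (exists y : 'rV[R]_m, KKT s (gf xb) phi dphi xb y) /\
  (LICQ s phi dphi xb ->
     forall y y' : 'rV[R]_m, KKT s (gf xb) phi dphi xb y ->
       KKT s (gf xb) phi dphi xb y' -> y' = y) /\
  (forall y : 'rV[R]_m, KKT s (gf xb) phi dphi xb y ->
     (forall y' : 'rV[R]_m, KKT s (gf xb) phi dphi xb y' -> y' = y) ->
     let Hy := \sum_(i < m) y ord0 i *: hphi i xb in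
     (forall w z, critS s phi dphi xb y w -> breve2 gf xb d w z ->
        0 <= dot z w + dot w (w *m Hy)) /\
     (forall sigma : R, 0 < sigma -> strong_local_min f (feasible s phi) xb sigma ->
        forall w z, critS s phi dphi xb y w -> breve2 gf xb d w z ->
          sigma * enorm w ^+ 2 <= dot z w + dot w (w *m Hy))).
Proof.
move=> _ d_gt0 f_grad [L gf_lip] phi_C2 xb_min mscq.
have xb_feas : feasible s phi xb by case: xb_min.
have xb_d : enorm (xb - xb) < d by rewrite subrr enorm0.
have phi_grad i u : enorm (u - xb) < d -> is_grad (phi i) (dphi i u) u.
  by case/(phi_C2 i).
have phi_jac i : is_jac (dphi i) (hphi i xb) xb by case: (phi_C2 i xb xb_d).
split.
  apply: (KKT_exists xb_feas mscq); [exact: f_grad| |exact: xb_min].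
  by move=> i; exact: phi_grad.
split=> [licq y y' y_KKT y'_KKT|y y_KKT y_uniq Hy].
  have [_ stat _] := y_KKT; have [_ stat' _] := y'_KKT.
  apply/rowP => i; apply/eqP; rewrite -subr_eq0; apply/eqP.
  (* Both multipliers vanish off the active constraints, so LICQ applies to their difference. *)
  apply: (licq (fun i => y' ord0 i - y ord0 i)) => [j nact|].
    have nsact y0 : ~~ strongly_active s phi xb y0 j.
      by apply: contraNN nact => /orP[->|/andP[-> _]//]; rewrite orbT.
    by rewrite (KKT_support xb_feas y_KKT)// (KKT_support xb_feas y'_KKT)// subrr.
  under eq_bigr do rewrite scalerBl.
  by rewrite sumrB; apply/eqP; rewrite subr_eq0 -(inj_eq (addrI (gf xb))) stat stat'.
split=> [w z w_crit wz|sigma sigma_gt0 xb_smin w z w_crit wz].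
  (* A local minimizer is a strong one with modulus 0. *)
  have xb_smin : strong_local_min f (feasible s phi) xb 0.
    split=> //; have [_ [r r_gt0 xb_le]] := xb_min; exists r => // x x_feas xr.
    by rewrite mul0r mul0r addr0; exact: xb_le.
  have := second_order_necessary d_gt0 f_grad gf_lip
    phi_grad phi_jac mscq (lexx 0) xb_smin y_KKT y_uniq w_crit wz.
  by rewrite mul0r.
exact: (second_order_necessary d_gt0 f_grad gf_lip
  phi_grad phi_jac mscq (ltW sigma_gt0) xb_smin y_KKT y_uniq w_crit wz).
Qed.
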